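(* Let $G$ be a profinite group with polynomial maximal subgroup growth. If $G$ has the bounded intersection property, then there exists a constant $\beta$ such that $c_n(G)\le n^\beta$ for every positive integer $n$.
   Context: Let $G$ be a profinite group; maximal subgroups of $G$ are understood to be open. $c_n(G)$ denotes the number of open subgroups of $G$ of index $n$ which are intersections of maximal subgroups of $G$, and $m_n(G)$ the number of maximal subgroups of $G$ of index $n$. $G$ has polynomial maximal subgroup growth (PMSG) if there exists $\alpha$ such that $m_n(G)\le n^\alpha$ for every $n\in\mathbb N$. $G$ has the bounded intersection property if there exists a positive real number $\eta$ such that for every open subgroup $H$ of $G$ which is an intersection of maximal subgroups of $G$ there exists a family of maximal subgroups $M_1,\dots,M_t$ of $G$ with $H=M_1\cap\dots\cap M_t$ and $|G:M_1|\cdots|G:M_t|\le|G:H|^\eta$. *)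

(* Defs.v *)
From HB Require Import structures.
From mathcomp Require Import all_boot all_order all_algebra.
From mathcomp Require Import finmap.
From mathcomp Require Import all_classical all_reals all_analysis.

Set Implicit Arguments.
Unset Strict Implicit.
Unset Printing Implicit Defensive.

Import Order.TTheory GRing.Theory Num.Theory.

Local Open Scope classical_set_scope.
Local Open Scope ring_scope.

HB.mixin Record Topological_isTopologicalGroup G
    & Topological G & Group G := {
  mulg_continuous : continuous (fun x : G * G => (x.1 * x.2)%g) ;
  invg_continuous : continuous (fun x : G => (x^-1)%g)
}.

#[short(type="topologicalGroupType")]
HB.structure Definition TopologicalGroup :=
  {G of Topological G & Group G & Topological_isTopologicalGroup G}.

Definition profinite (G : topologicalGroupType) : Prop :=
  [/\ compact [set: G], hausdorff_space G & totally_disconnected [set: G]].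

Definition is_subgroup (G : groupType) (H : set G) : Prop :=
  group_closed (mem H).

Definition open_subgroup (G : topologicalGroupType) (H : set G) : Prop :=
  is_subgroup H /\ open H.

Definition left_cosets (G : groupType) (H : set G) : set (set G) :=
  [set [set (x * h)%g | h in H] | x in [set: G]].

(* fset_set of an infinite set is empty, so an infinite index reads as 0 and
   subgroup_index H = n with 0 < n means that H has finite index n.
   Open subgroups of a profinite group always have finite index. *)
Definition subgroup_index (G : groupType) (H : set G) : nat :=
  #|` fset_set (left_cosets H)|.

(* K ranges over all subgroups, not only open or closed ones. *)
Definition maximal_subgroup (G : topologicalGroupType) (M : set G) : Prop :=
  [/\ open_subgroup M, M != [set: G] &
      forall K : set G, is_subgroup K -> M `<=` K -> K = M \/ K = [set: G]].

(* The family F may be infinite; it may also be empty, in which case H = G. *)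
Definition intersection_of_maximals (G : topologicalGroupType)
    (H : set G) : Prop :=
  exists F : set (set G), F `<=` @maximal_subgroup G /\ H = \bigcap_(M in F) M.

(* The two counts are extended reals, equal to +oo when the set is infinite. *)
Definition num_maximal (R : realType) (G : topologicalGroupType)
    (n : nat) : \bar R :=
  counting [set M : set G | maximal_subgroup M /\ subgroup_index M = n].

Definition num_intersection (R : realType) (G : topologicalGroupType)
    (n : nat) : \bar R :=
  counting [set H : set G | [/\ open_subgroup H, intersection_of_maximals H &
                                subgroup_index H = n]].

Definition PMSG (R : realType) (G : topologicalGroupType) : Prop :=
  exists alpha : R, forall n : nat, (0 < n)%N ->
    (num_maximal R G n <= (n%:R `^ alpha)%:E)%E.

Definition bounded_intersection_property (R : realType)
    (G : topologicalGroupType) : Prop :=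
  exists eta : R, 0 < eta /\
    forall H : set G, open_subgroup H -> intersection_of_maximals H ->
      exists (t : nat) (M : 'I_t -> set G),
        [/\ forall i, maximal_subgroup (M i),
            H = \bigcap_i M i &
            (\prod_(i < t) subgroup_index (M i))%N%:R
              <= (subgroup_index H)%:R `^ eta].

(* Main.v *)
(** An intersection of maximal subgroups of index [n] is determined by a word
    of maximal subgroups whose indices have product at most [n ^ eta].  If there
    are at most [k ^ a] letters of weight [k >= 2], then, conditioning on the
    first letter, the number [A X] of words of weight at most [X] satisfies
    [A X <= 1 + \sum_(2 <= k <= X) k ^ a * A (X / k)], and since
    [\sum_(2 <= k <= X) 1 / k ^ 2 <= 1 - 1 / X] it follows inductively that
    [A X <= X ^ (a + 2)]. *)

Require Import Defs.
From mathcomp Require Import all_boot all_order all_algebra.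
From mathcomp Require Import finmap zify ring.
From mathcomp Require Import all_classical all_reals all_analysis.

Import Order.TTheory GRing.Theory Num.Theory.

Local Open Scope ring_scope.

(* A form of [\sum_(2 <= k <= m) 1 / k ^ 2 <= 1 - 1 / m] without division. *)
Lemma sum_divn_sqr (X m : nat) :
  (0 < m -> m * (\sum_(2 <= k < m.+1) (X %/ k) ^ 2) <= X ^ 2 * m.-1)%N.
Proof.
elim: m => // -[_ _|m IHm _]; first by rewrite big_geq.
have {}IHm := IHm isT; rewrite big_nat_recr //=.
set S := (\sum_(2 <= k < m.+2) _)%N in IHm *; set q := (X %/ m.+2)%N.
have qX : (q * m.+2 <= X)%N by exact: leq_divM.
have sq : ((q * m.+2) ^ 2 <= X ^ 2)%N by rewrite leq_sqr.
(* The factor [m.+1] exposes the induction hypothesis; the new term is handled by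
   [1 / k ^ 2 <= 1 / (k - 1) - 1 / k] with [k = m.+2]. *)
rewrite -(leq_pmul2l (ltn0Sn m)).
have le1 : (m.+1 * m.+2 * q ^ 2 <= X ^ 2)%N.
  by apply: leq_trans sq; rewrite mulnC expnMn leq_mul2l leq_mul ?orbT.
have -> : (m.+1 * (m.+2 * (S + q ^ 2))
           = m.+2 * (m.+1 * S) + m.+1 * m.+2 * q ^ 2)%N by ring.
have -> : (m.+1 * (X ^ 2 * m.+1) = m.+2 * (X ^ 2 * m) + X ^ 2)%N by ring.
by rewrite leq_add// leq_mul.
Qed.

(** As [k * (X %/ k) <= X], each term is at most [X ^ a * (X %/ k) ^ 2], and the squares sum to at
    most [X * (X - 1)]. The slack [X ^ a * X] absorbs the leading 1. *)
Lemma sum_divn_expn (a X : nat) : (0 < X)%N ->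
  (1 + \sum_(2 <= k < X.+1) k ^ a * (X %/ k) ^ (a + 2) <= X ^ (a + 2))%N.
Proof.
move=> X0.
have le_term k : (k ^ a * (X %/ k) ^ (a + 2) <= X ^ a * (X %/ k) ^ 2)%N.
  rewrite expnD mulnA -expnMn leq_mul2r; apply/orP; right.
  by case: a => // a; rewrite leq_exp2r// mulnC leq_divM.
have le_sum : (\sum_(2 <= k < X.+1) (X %/ k) ^ 2 <= X * X.-1)%N.
  by rewrite -(leq_pmul2l X0) mulnA mulnn sum_divn_sqr.
apply: (@leq_trans (1 + X ^ a * (X * X.-1))%N).
  rewrite leq_add2l (leq_trans (leq_sum _ (fun k _ => le_term k)))//.
  by rewrite -big_distrr/= leq_mul.
apply: (@leq_trans (X ^ a * (1 + X * X.-1))%N).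
  by rewrite mulnDr muln1 leq_add2r expn_gt0 X0.
by rewrite expnD leq_mul//; case: X X0 {le_term le_sum} => // X _ /=; lia.
Qed.

(** A covering list, possibly with repetitions, suffices for an upper bound. Since letters weigh at
    least 2, removing the first one strictly lowers the bound [X], so strong induction applies. *)
Lemma words_of_bounded_weight (T : eqType) (w : T -> nat)
    (letters : nat -> seq T) (a : nat) :
  (forall k, 1 < k -> size (letters k) <= k ^ a)%N ->
  forall X, (0 < X)%N -> exists2 s : seq (seq T), (size s <= X ^ (a + 2))%N &
    forall l, {in l, forall x, (1 < w x)%N /\ x \in letters (w x)} ->
      (\prod_(x <- l) w x <= X)%N -> l \in s.
Proof.
move=> hletters X; have [n] := ubnP X; elim: n X => // n IHn X /ltnSE ltXn X0.
(* The range of [k] is a premise inside each property, so that choice yields a total function [s];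
   out of range it may be empty. *)
have /(_ _)/cid2-/all_sig2[s size_s mem_s] : forall k : nat,
    exists2 s : seq (seq T),
      ((1 < k <= X)%N -> size s <= (X %/ k) ^ (a + 2))%N &
    (1 < k <= X)%N ->
    forall l, {in l, forall x, (1 < w x)%N /\ x \in letters (w x)} ->
      (\prod_(x <- l) w x <= X %/ k)%N -> l \in s.
  move=> k; have [/andP[k1 kX]|_] := boolP (1 < k <= X)%N; last by exists [::].
  have [||s ? ?] := IHn (X %/ k)%N; last by exists s.
    by rewrite (leq_trans _ ltXn)// ltn_Pdiv.
  by rewrite divn_gt0// (ltn_trans _ k1).
(* The empty word accounts for the 1 in the recursion; [k] is the weight of the first letter. *)
exists ([::] :: flatten [seq [seq x :: l | x <- letters k, l <- s k]
                        | k <- index_iota 2 X.+1]).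
  apply: leq_trans (sum_divn_expn a X X0).
  rewrite /= add1n ltnS size_flatten /shape -map_comp sumnE big_map.
  rewrite !big_seq; apply: leq_sum => k.
  rewrite mem_index_iota => /andP[k1 kX] /=.
  by rewrite size_allpairs leq_mul ?hletters ?size_s ?k1.
move=> [//|x l] hl; rewrite big_cons => le_prod.
have [wx1 xin] := hl x (mem_head _ _).
have hl' : {in l, forall x, (1 < w x)%N /\ x \in letters (w x)}.
  by move=> y yl; apply: hl; rewrite inE yl orbT.
have prod_gt0 : (0 < \prod_(y <- l) w y)%N.
  by rewrite big_seq prodn_cond_gt0// => y /hl'[/ltnW].
have wxX : (w x <= X)%N by rewrite (leq_trans _ le_prod)// leq_pmulr.
rewrite inE; apply/orP; right; apply/flattenP.
exists [seq y :: l' | y <- letters (w x), l' <- s (w x)].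
  by apply/mapP; exists (w x); rewrite // mem_index_iota wx1.
apply/allpairsP; exists (x, l); split => //=.
by apply: mem_s; rewrite ?wx1// leq_divRL 1?mulnC// (ltn_trans _ wx1).
Qed.

Lemma counting_le_size (R : realType) (T : choiceType) (A : set T) (s : seq T) :
  (forall x, A x -> x \in s) -> (counting A <= (size s)%:R%:E :> \bar R)%E.
Proof.
move=> As; have finA : finite_set A.
  by apply: sub_finite_set (finite_seq s) => x /As.
rewrite /counting asboolT// lee_fin ler_nat uniq_leq_size ?fset_uniq// => x.
by rewrite in_fset_set// => /set_mem /As.
Qed.

Lemma finite_set_counting (R : realType) (T : choiceType) (A : set T) (r : R) :
  (counting A <= r%:E)%E -> finite_set A /\ #|` fset_set A|%:R <= r.
Proof. by rewrite /counting; case: asboolP => //; rewrite lee_fin. Qed.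

Local Open Scope classical_set_scope.

Lemma subgroup_index_gt0_finite (G : groupType) (H : set G) :
  (0 < subgroup_index H)%N -> finite_set (left_cosets H).
Proof.
move=> H0; apply: contrapT => infH; move: H0.
by rewrite /subgroup_index /fset_set; case: pselect.
Qed.

(** Right multiplication by [M] sends the coset [xH] to [xM]. *)
Lemma finite_left_cosetsS (G : groupType) (H M : set G) :
  is_subgroup H -> is_subgroup M -> H `<=` M ->
  finite_set (left_cosets H) -> finite_set (left_cosets M).
Proof.
move=> [H1 _] gM HM finH.
apply: sub_finite_set
  (finite_image (fun C => [set (c * m)%g | c in C & m in M]) finH).
move=> _ [x _ <-]; exists [set (x * h)%g | h in H]; first by exists x.
apply/seteqP; split=> y.
  move=> [_ [h Hh <-] [m Mm <-]]; exists (h * m)%g; last by rewrite mulgA.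
  by apply/set_mem/(group_closedM gM); rewrite inE //; exact: HM.
move=> [m Mm <-]; exists x; last by exists m.
by exists 1%g; [exact: set_mem|rewrite mulg1].
Qed.

(** Any [x] outside [M] gives a second coset [xM]; finiteness excludes the default index 0. Thus
    proper subgroups of finite index are admissible letters. *)
Lemma subgroup_index_gt1 (G : groupType) (M : set G) :
  is_subgroup M -> finite_set (left_cosets M) -> M != [set: G] ->
  (1 < subgroup_index M)%N.
Proof.
move=> [M1 _] finM MT; rewrite /subgroup_index.
have [x Mx] : exists x, ~ M x.
  apply: contrapT => allM; move/eqP: MT; apply; apply/seteqP; split=> // x _.
  by apply: contrapT => Mx; apply: allM; exists x.
have coset y : [set (y * h)%g | h in M] \in fset_set (left_cosets M).
  by rewrite in_fset_set// inE; exists y.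
apply: leq_trans (fsubset_leq_card (_ : [fset [set (1 * h)%g | h in M];
  [set (x * h)%g | h in M]] `<=` _)%fset); last first.
  by apply/fsubsetP => C; rewrite !inE => /orP[] /eqP ->.
rewrite cardfs2 ltnS lt0b; apply/eqP => /seteqP[_ /(_ x)] [].
  by exists 1%g; [exact: set_mem|rewrite mulg1].
by move=> y My; rewrite mul1g => yx; apply: Mx; rewrite -yx.
Qed.

Theorem proposition4 (R : realType) (G : topologicalGroupType) :
  profinite G -> PMSG R G -> bounded_intersection_property R G ->
  exists beta : R, forall n : nat, (0 < n)%N ->
    (num_intersection R G n <= (n%:R `^ beta)%:E)%E.
Proof.
move=> _ [alpha hmax] [eta [_ hbip]].
(* Real exponents are replaced by natural ones, as the word count is done in [nat]. *)
have bound (r : R) : exists k : nat, forall n, (0 < n)%N ->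
    n%:R `^ r <= (n ^ k)%:R :> R.
  exists (Num.bound `|r|) => n n0; rewrite natrX -powR_mulrn//.
  rewrite ler_powR ?ler1n// (le_trans (ler_norm r))// ltW// archi_boundP//.
have [a ha] := bound alpha; have [e he] := bound eta.
pose maximals k :=
  fset_set [set M : set G | maximal_subgroup M /\ subgroup_index M = k].
have maximalsP k : (0 < k)%N -> (#|` maximals k| <= k ^ a)%N /\
    forall M, maximal_subgroup M -> subgroup_index M = k -> M \in maximals k.
  move=> k0; have [fin_k card_k] := finite_set_counting _ _ _ _ (hmax k k0).
  split; first by rewrite -(ler_nat R) (le_trans card_k)// ha.
  by move=> M maxM iM; rewrite in_fset_set// inE.
(* Words of weight at most [n ^ e] number at most [(n ^ e) ^ (a + 2)]. *)
exists (e * (a + 2))%:R => n n0.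
have [||s size_s mem_s] := @words_of_bounded_weight (set G)
  (@subgroup_index G) (fun k => enum_fset (maximals k)) a _ (n ^ e)%N.
- by move=> k /ltnW /maximalsP[].
- by rewrite expn_gt0 n0.
apply: le_trans (counting_le_size R _ _
  [seq \bigcap_(M in [set` l]) M | l <- s] _) _; last first.
  rewrite lee_fin size_map powR_mulrn// -natrX ler_nat expnM.
  exact: size_s.
move=> H [oH iH indH]; have [t [M [maxM HM le_prod]]] := hbip H oH iH.
have finH : finite_set (left_cosets H).
  by apply: subgroup_index_gt0_finite; rewrite indH.
have ind_gt1 i : (1 < subgroup_index (M i))%N.
  have [[gM _] MT _] := maxM i; apply: subgroup_index_gt1 => //.
  by apply: finite_left_cosetsS finH => //; [case: oH|rewrite HM => x; exact].
(* The family given by bounded intersection, read as a word, has weight at most [n ^ e] and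
   intersection [H]. *)
apply/mapP; exists [seq M i | i <- enum 'I_t].
  apply: mem_s.
    move=> _ /mapP[i _ ->]; split=> //.
    by have [_] := maximalsP _ (ltnW (ind_gt1 i)); exact.
  rewrite big_map big_enum /= -(ler_nat R) (le_trans le_prod)//.
  by rewrite indH he.
rewrite {1}HM; apply/seteqP; split=> x Mx.
  by move=> _ /mapP[i _ ->]; exact: Mx.
by move=> i _; apply: Mx; apply/mapP; exists i; rewrite ?mem_enum.
Qed.
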